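(* Let $K$ be a field and let $f:\mathbb N\to\mathbb N$ be a non-decreasing function. The following conditions are equivalent: (i) for every nonzero proper squarefree monomial ideal $I$ (in a polynomial ring over $K$ in any finite number of variables), $d(I^{(k)})\le k f(d(I))$ for all integers $k\ge1$; (ii) $n\le\mathrm{ht}(I)\,f(d(I))$ for every $n$ and every nonzero proper squarefree monomial ideal $I$ in a polynomial ring $K[x_1,\dots,x_n]$ such that every variable $x_1,\dots,x_n$ belongs to at least one minimal prime of $I$ of height $\mathrm{ht}(I)$.
   Context: $\mathbb N$ includes $0$. For a monomial ideal $J$, $d(J)$ is the maximum degree of a minimal monomial generator of $J$. $\mathrm{ht}(I)$ is the height of $I$, i.e. the minimal height of a minimal prime of $I$. $I^{(k)}$ is the $k$-th symbolic power; for a squarefree monomial ideal, $I^{(k)}=\bigcap_{P\in\mathrm{Min}(I)}P^k$, with $\mathrm{Min}(I)$ the set of minimal primes of $I$. *)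

(* Defs.v *)
From HB Require Import structures.
From mathcomp Require Import all_boot all_order all_algebra.
From mathcomp Require Import ring_quotient classical_sets mpoly.

Set Implicit Arguments.
Unset Strict Implicit.
Unset Printing Implicit Defensive.

Import Order.TTheory GRing.Theory.

Local Open Scope classical_set_scope.
Local Open Scope ring_scope.

(* Ideals are sets of ring elements. The closure predicates of ring_quotient   *)
(* take collective predicates, hence the coercion through mem; note that       *)
(* idealr_closed includes properness (1 \notin P).                             *)
Definition prime_ideal (R : comNzRingType) (P : set R) : Prop :=
  idealr_closed (mem P) /\ prime_idealr_closed (mem P).

Definition ideal_span (R : comNzRingType) (S : set R) : set R :=
  [set x | exists2 s : seq (R * R), (forall u, u \in s -> S u.2)
                                   & x = \sum_(u <- s) u.1 * u.2].

Definition ideal_pow (R : comNzRingType) (I : set R) (k : nat) : set R :=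
  ideal_span [set x | exists2 y : 'I_k -> R, (forall i, I (y i))
                                            & x = \prod_(i < k) y i].

Definition minimal_primes (R : comNzRingType) (I : set R) : set (set R) :=
  [set P | [/\ prime_ideal P, I `<=` P
    & forall Q, prime_ideal Q -> I `<=` Q -> Q `<=` P -> Q = P]].

Definition prime_chain (R : comNzRingType) (P : set R) (h : nat) : Prop :=
  exists C : nat -> set R,
    [/\ forall i, (i <= h)%N -> prime_ideal (C i),
        forall i, (i < h)%N -> C i `<` C i.+1
      & C h = P].

(* A set of naturals that is unbounded has supremum 0 under this encoding; in  *)
(* K[x_1, .., x_n] the suprema and infima below are attained.                  *)
Definition prime_height (R : comNzRingType) (P : set R) : nat :=
  supremum 0%N [set h | prime_chain P h].

Definition height (R : comNzRingType) (I : set R) : nat :=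
  infimum 0%N [set prime_height P | P in minimal_primes I].

(* k-th symbolic power; this formula is the one for squarefree monomial ideals *)
Definition symbolic_power (R : comNzRingType) (I : set R) (k : nat) : set R :=
  \bigcap_(P in minimal_primes I) ideal_pow P k.

Section MonomialIdeals.
Variables (K : fieldType) (n : nat).

Definition monomial_span (G : set 'X_{1..n}) : set {mpoly K[n]} :=
  ideal_span [set 'X_[m] | m in G].

Definition squarefree_monomial_ideal (I : set {mpoly K[n]}) : Prop :=
  exists2 G : set 'X_{1..n},
    (forall m, G m -> forall i, (m i <= 1)%N) & I = monomial_span G.

Definition minimal_monomial_generators (J : set {mpoly K[n]})
    (G : set 'X_{1..n}) : Prop :=
  J = monomial_span G /\
  forall G', G' `<=` G -> J = monomial_span G' -> G' = G.

Definition gen_degree (J : set {mpoly K[n]}) : nat :=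
  supremum 0%N [set e | exists G m,
    [/\ minimal_monomial_generators J G, G m & e = mdeg m]].

End MonomialIdeals.

(* Main.v *)
(* A prime containing a monomial ideal contains the face prime generated by its variables, so
   the minimal primes of a squarefree monomial ideal are the face primes of the minimal vertex
   covers F of its clutter, and x^a lies in I^(k) iff a(F) >= k for all of them.

   (i) => (ii): if every variable lies in a minimal cover of size h = ht(I), then x_1 ... x_n is
   a minimal generator of I^(h), so n <= d(I^(h)).

   (ii) => (i): if x^a is a minimal generator of I^(k), replace each vertex i by a_i copies. The
   minimal covers of the new clutter are preimages of minimal covers F of the old one, of size
   a(F) >= k, and minimality of x^a puts each new vertex in one of size k. The new ideal J thus
   has height k, deg(x^a) variables, and d(J) <= d(I).

   Height of a face prime: along a chain C_0 < ... < C_h = P_F pick g_i in C_i \ C_(i-1). The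
   g_i together with the variables outside F are algebraically independent, and counting
   monomials of bounded degree shows that there are at most n of them, so h <= |F|. *)
Require Import Defs.
From mathcomp Require Import all_boot all_order all_algebra.
From mathcomp Require Import ring_quotient boolp classical_sets mpoly.

Set Implicit Arguments.
Unset Strict Implicit.
Unset Printing Implicit Defensive.

Import Order.TTheory GRing.Theory.

Local Open Scope classical_set_scope.
Local Open Scope ring_scope.

(** * Suprema and infima of sets of naturals *)

Section NatSup.
Implicit Types (A : set nat) (b x : nat).

Lemma nat_supremum_le A b : ubound A b -> (supremum 0%N A <= b)%N.
Proof.
(* Both fallbacks, for empty [A] and for a missing supremum, are [0], which is below any [b]. *)
move=> Ab; rewrite /supremum; case: ifPn => // _.
by case: xgetP => [y _ [_ yA]|//]; rewrite -leEnat; apply: yA.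
Qed.

Lemma nat_le_supremum A b x : ubound A b -> A x -> (x <= supremum 0%N A)%N.
Proof.
move=> Ab Ax; rewrite -leEnat; apply: ge_supremum_Nmem Ax.
by apply: nat_supremums_neq0; exists b.
Qed.

Lemma nat_infimum_eq A x : A x -> lbound A x -> infimum 0%N A = x.
Proof.
move=> Ax xA; rewrite /infimum ifF; last by apply/negbTE/set0P; exists x.
have xinf : infimums A x by split=> // y; apply.
case: xgetP => [y yinf [yA1 yA2]|/(_ x)//].
exact: (is_subset1_infimums (conj yA1 yA2) xinf).
Qed.

End NatSup.

(** * Generated ideals and prime ideals *)

Section Ideals.
Variable R : comNzRingType.
Implicit Types (P S : set R).

Lemma prime_idealP P : prime_ideal P <->
  [/\ P 0, ~ P 1, forall a u v, P u -> P v -> P (a * u + v)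
    & forall u v, P (u * v) -> P u \/ P v].
Proof.
split=> [[[P0 P1 PD] PM]|[P0 P1 PD PM]].
  split; first by move: P0; rewrite /in_mem /= => /set_mem.
  - by move=> h; move/negP: P1; apply; apply/mem_set.
  - move=> a u v Pu Pv.
    by apply: set_mem; apply: (PD a u v); apply: mem_set.
  - move=> u v /mem_set /PM /orP[] h; [left|right]; exact: set_mem.
split; first split.
- exact: mem_set.
- by apply/negP => /set_mem.
- by move=> a u v /set_mem Pu /set_mem Pv; apply: mem_set; apply: PD.
- move=> u v /set_mem /PM[] h; apply/orP; [left|right]; exact: mem_set.
Qed.

Lemma ideal_span_sub S P :
  P 0 -> (forall a u v, P u -> P v -> P (a * u + v)) ->
  S `<=` P -> ideal_span S `<=` P.
Proof.
move=> P0 PD SP x [s sS ->]; elim: s sS => [|u s IH] sS; first by rewrite big_nil.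
rewrite big_cons; apply: PD; first by apply/SP/sS; rewrite mem_head.
by apply: IH => v vs; apply: sS; rewrite in_cons vs orbT.
Qed.

Lemma ideal_spanM S a x : S x -> ideal_span S (a * x).
Proof.
move=> Sx; exists [:: (a, x)]; last by rewrite big_seq1.
by move=> u; rewrite mem_seq1 => /eqP ->.
Qed.

Lemma ideal_span0 S : ideal_span S 0.
Proof. by exists [::]; rewrite ?big_nil. Qed.

Lemma ideal_spanD S x y : ideal_span S x -> ideal_span S y -> ideal_span S (x + y).
Proof.
move=> [s sS ->] [t tS ->]; exists (s ++ t); last by rewrite big_cat.
by move=> u; rewrite mem_cat => /orP[/sS|/tS].
Qed.

Lemma ideal_span_sum S (T : eqType) (r : seq T) (F : T -> R) :
  (forall i, i \in r -> ideal_span S (F i)) -> ideal_span S (\sum_(i <- r) F i).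
Proof.
elim: r => [|i r IH] h; first by rewrite big_nil; apply: ideal_span0.
rewrite big_cons; apply: ideal_spanD; first by apply: h; rewrite mem_head.
by apply: IH => j jr; apply: h; rewrite in_cons jr orbT.
Qed.

Lemma prime_ideal_prod P (I : finType) (D : pred I) (F : I -> R) :
  prime_ideal P -> P (\prod_(i | D i) F i) -> exists2 i, D i & P (F i).
Proof.
move=> /prime_idealP[_ P1 _ PM]; elim/big_rec: _ => // i x Di IH /PM[]//.
by exists i.
Qed.

Lemma prime_ideal_exp P x k : prime_ideal P -> P (x ^+ k) -> (0 < k)%N /\ P x.
Proof.
move=> /prime_idealP[_ P1 _ PM]; elim: k => [//|k IH].
by rewrite exprS => /PM[|/IH[]].
Qed.

End Ideals.

(** * Monomial ideals as upward-closed sets of exponents *)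

Section Supported.
Variables (K : fieldType) (n : nat).
Implicit Types (U V G : set 'X_{1..n}) (p q : {mpoly K[n]}) (m g : 'X_{1..n}).

(** For upward-closed [U] this is a monomial ideal, and [U] can be recovered from it. Other [U]
    occur too, such as the exponents that avoid a set of variables. *)
Definition supported U : set {mpoly K[n]} :=
  [set p | forall m, m \in msupp p -> U m].

Definition upward U := forall m m', U m -> (m <= m')%MM -> U m'.

Definition upset G : set 'X_{1..n} := [set m | exists2 g, G g & (g <= m)%MM].

Lemma upset_upward G : upward (upset G).
Proof. by move=> m m' [g Gg gm] mm'; exists g => //; apply: lepm_trans mm'. Qed.

Lemma sub_upset G : G `<=` upset G.
Proof. by move=> g Gg; exists g => //; apply: lepm_refl. Qed.

Lemma supportedX U m : supported U 'X_[m] <-> U m.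
Proof.
split=> [|Um m']; first by apply; rewrite msuppX mem_head.
by rewrite msuppX mem_seq1 => /eqP ->.
Qed.

Lemma supported_inj U V : supported U = supported V -> U = V.
Proof.
move=> e; apply/seteqP; split=> m h; apply/supportedX.
  by rewrite -e; apply/supportedX.
by rewrite e; apply/supportedX.
Qed.

Lemma supported0 U : supported U 0.
Proof. by move=> m; rewrite msupp0. Qed.

Lemma supportedD U p q : supported U p -> supported U q -> supported U (p + q).
Proof. by move=> Up Uq m /msuppD_le; rewrite mem_cat => /orP[/Up|/Uq]. Qed.

Lemma supportedZ U c p : supported U p -> supported U (c *: p).
Proof. by move=> Up m /msuppZ_le /Up. Qed.

Lemma supported_sum U (T : Type) (r : seq T) (D : pred T) (F : T -> {mpoly K[n]}) :
  (forall i, D i -> supported U (F i)) -> supported U (\sum_(i <- r | D i) F i).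
Proof.
move=> h; elim/big_rec: _ => [|i x Di Ux]; first exact: supported0.
exact: supportedD (h i Di) Ux.
Qed.

(** Three separate sets serve three uses: absorption by an ideal, products inside powers of a face
    prime, and products of polynomials free of [F]. *)
Lemma supportedM U V W p q : (forall m m', U m -> V m' -> W (m + m')%MM) ->
  supported U p -> supported V q -> supported W (p * q).
Proof. by move=> h Up Vq m /msuppM_le /allpairsP[[a b] /= [/Up ? /Vq ? ->]]; exact: h. Qed.

Lemma supportedMl U p q : upward U -> supported U q -> supported U (p * q).
Proof.
move=> uU; apply: (@supportedM setT) => // m m' _ Um'.
exact: uU Um' (lem_addl _ _).
Qed.

Lemma supported_lin U : upward U ->
  forall a u v, supported U u -> supported U v -> supported U (a * u + v).
Proof. by move=> uU a u v Uu Uv; apply: supportedD => //; apply: supportedMl. Qed.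

(** The right side is an ideal because up-sets absorb addition; conversely, every term of a
    polynomial in it is a multiple of a generator. *)
Lemma monomial_spanE G : monomial_span G = supported (upset G).
Proof.
apply/seteqP; split.
  apply: ideal_span_sub; [exact: supported0|exact: supported_lin (@upset_upward _)|].
  by move=> _ [m Gm <-]; apply/supportedX/sub_upset.
move=> p Up; rewrite [p]mpolyE; apply: ideal_span_sum => m /Up[g Gg gm].
rewrite -(submK gm) mpolyXD scalerAl; apply: ideal_spanM.
by exists g.
Qed.

Lemma supported1 U : upward U -> supported U = setT <-> U 0%MM.
Proof.
move=> uU; split=> [e|U0]; first by apply/supportedX; rewrite e.
by apply/seteqP; split=> // p _ m _; apply: uU U0 _; apply/mnm_lepP => i; rewrite mnm0E.
Qed.

Definition minimal_in U : set 'X_{1..n} :=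
  [set m | U m /\ forall m', U m' -> (m' <= m)%MM -> m' = m].

Lemma lepm_mdeg_eq m m' : (m <= m')%MM -> (mdeg m' <= mdeg m)%N -> m = m'.
Proof.
move=> le; rewrite -{1 2}(submK le) mdegD -[X in (_ <= X)%N -> _]add0n leq_add2r leqn0 mdeg_eq0.
by move=> /eqP ->; rewrite add0m.
Qed.

Lemma minimal_below U m : U m -> exists2 g, minimal_in U g & (g <= m)%MM.
Proof.
have [d] := ubnP (mdeg m); elim: d m => // d IH m; rewrite ltnS => md Um.
have [min|] := pselect (minimal_in U m); first by exists m; rewrite ?lepm_refl.
move=> nmin; have /existsNP[m' /not_implyP[Um' /not_implyP[le ne]]] :
  ~ forall m', U m' -> (m' <= m)%MM -> m' = m by move=> h; apply: nmin.
have lt : (mdeg m' < mdeg m)%N.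
  by rewrite ltnNge; apply/negP => /(lepm_mdeg_eq le).
have [g gmin gm'] := IH m' (leq_trans lt md) Um'.
by exists g => //; apply: lepm_trans le.
Qed.

Lemma upset_minimal_in U : upward U -> upset (minimal_in U) = U.
Proof.
move=> uU; apply/seteqP; split=> [m [g [Ug _]]|m /minimal_below[g]].
  exact: uU.
by exists g.
Qed.

Lemma minimal_in_upset G : minimal_in (upset G) `<=` G.
Proof.
by move=> m [[g Gg gm] min]; rewrite -(min g) //; apply: sub_upset.
Qed.

(** Every generating set contains the minimal exponents, and these already generate, so the minimal
    generating set is unique. *)
Lemma minimal_monomial_generatorsE U G : upward U ->
  minimal_monomial_generators (supported U) G <-> G = minimal_in U.
Proof.
move=> uU; rewrite /minimal_monomial_generators; split=> [[]|->].
  rewrite monomial_spanE => /supported_inj eU min; apply/esym/min.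
    by rewrite eU; apply: minimal_in_upset.
  by rewrite monomial_spanE upset_minimal_in.
split=> [|G' sG' ]; first by rewrite monomial_spanE upset_minimal_in.
rewrite monomial_spanE => /supported_inj eU; apply/seteqP; split=> // m.
by rewrite eU; apply: minimal_in_upset.
Qed.

Lemma gen_degreeE U : upward U ->
  gen_degree (supported U) = supremum 0%N [set mdeg m | m in minimal_in U].
Proof.
move=> uU; congr supremum; apply/seteqP; split=> [e [G [m [hG Gm ->]]]|_ [m Um <-]].
  by exists m => //; rewrite -((minimal_monomial_generatorsE G uU).1 hG).
exists (minimal_in U), m; split=> //; exact/minimal_monomial_generatorsE.
Qed.

Lemma gen_degree_le U b : upward U ->
  (forall m, minimal_in U m -> (mdeg m <= b)%N) -> (gen_degree (supported U) <= b)%N.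
Proof.
by move=> uU h; rewrite gen_degreeE //; apply: nat_supremum_le => _ [m /h ? <-].
Qed.

(** The exponent bound [b] bounds all degrees by [n * b], so the supremum is a true one and not the
    default [0]. *)
Lemma le_gen_degree U b m : upward U ->
  (forall m, minimal_in U m -> forall i, (m i <= b)%N) ->
  minimal_in U m -> (mdeg m <= gen_degree (supported U))%N.
Proof.
move=> uU h Um; rewrite gen_degreeE //; apply: (@nat_le_supremum _ (n * b)).
  move=> _ [m' /h m'b <-]; rewrite leEnat mdegE.
  by rewrite -[n in X in (_ <= X)%N]card_ord -sum_nat_const leq_sum.
by exists m.
Qed.

End Supported.

(** * Face primes, their powers, and minimal covers *)

Section FacePrimes.
Variables (K : fieldType) (n : nat).
Implicit Types (F : {set 'I_n}) (p q : {mpoly K[n]}) (m g : 'X_{1..n}).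
Implicit Types (G : set 'X_{1..n}) (P Q : set {mpoly K[n]}).

(** The order of a monomial along the face prime of [F]: the largest power of that prime containing
    it. *)
Definition fdeg F m : nat := (\sum_(i in F) m i)%N.

Definition face_pow F k : set {mpoly K[n]} :=
  supported [set m | (k <= fdeg F m)%N].

Definition face_prime F := face_pow F 1.

Lemma fdegD F m m' : fdeg F (m + m')%MM = (fdeg F m + fdeg F m')%N.
Proof. by rewrite /fdeg -big_split /=; apply: eq_bigr => i _; rewrite mnmDE. Qed.

Lemma fdeg0 F : fdeg F 0%MM = 0%N.
Proof. by rewrite /fdeg big1 // => i _; rewrite mnm0E. Qed.

Lemma fdeg1 F i : fdeg F U_(i)%MM = (i \in F).
Proof.
rewrite /fdeg; case: (boolP (i \in F)) => iF.
  rewrite (bigD1 i) //= mnm1E eqxx big1 ?addn0 // => j /andP[_ ji].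
  by rewrite mnm1E eq_sym (negbTE ji).
by rewrite big1 // => j jF; rewrite mnm1E; case: eqP iF => // ->; rewrite jF.
Qed.

Lemma fdeg_le F m m' : (m <= m')%MM -> (fdeg F m <= fdeg F m')%N.
Proof. by move=> le; rewrite -(submK le) fdegD leq_addl. Qed.

Lemma fdeg_gt0 F m : (0 < fdeg F m)%N -> exists2 i, i \in F & (0 < m i)%N.
Proof.
rewrite lt0n /fdeg sum_nat_eq0 negb_forall => /existsP[i].
by rewrite negb_imply -lt0n => /andP[]; exists i.
Qed.

Lemma fdeg_gt0_var F m i : i \in F -> (0 < m i)%N -> (0 < fdeg F m)%N.
Proof. by move=> iF mi; rewrite /fdeg (bigD1 i) //= addn_gt0 mi. Qed.

Lemma fdeg_upward F k : upward [set m | (k <= fdeg F m)%N].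
Proof. by move=> m m' /= km /(fdeg_le F); apply: leq_trans. Qed.

Lemma face_pow_lin F k a p q :
  face_pow F k p -> face_pow F k q -> face_pow F k (a * p + q).
Proof. exact: supported_lin (@fdeg_upward F k) _ _ _. Qed.

Lemma face_primeX F i : face_prime F 'X_i <-> i \in F.
Proof.
split=> [/supportedX|iF]; first by rewrite /= fdeg1; case: (i \in F).
by apply/supportedX; rewrite /= fdeg1 iF.
Qed.

(** Polynomials in the variables outside [F]; they represent the quotient by the face prime. *)
Definition face_free F p := supported [set m | fdeg F m = 0%N] p.

Lemma face_free_eq0 F p : face_free F p -> face_prime F p -> p = 0.
Proof.
move=> Fp Pp; apply: msuppnil0; case E: (msupp p) => [//|m s].
have mp : m \in msupp p by rewrite E mem_head.
by have /= := Pp _ mp; rewrite (Fp _ mp).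
Qed.

Lemma face_free_proj F p : exists2 q, face_free F q & face_prime F (p - q).
Proof.
exists (\sum_(m <- msupp p | fdeg F m == 0%N) p@_m *: 'X_[m]).
  by apply: supported_sum => m /eqP m0; apply: supportedZ; apply/supportedX.
rewrite {1}[p]mpolyE (bigID (fun m => fdeg F m == 0%N)) /= addrAC subrr add0r.
by apply: supported_sum => m m0; apply: supportedZ; apply/supportedX; rewrite /= lt0n.
Qed.

(** The product of the [F]-free parts of two factors is [F]-free and, if the product of the factors
    lies in the face prime, lies there too. It is then zero, and polynomials over a field form a
    domain. *)
Lemma face_prime_prime F : prime_ideal (face_prime F).
Proof.
have oppP p : face_prime F p -> face_prime F (- p).
  move=> Pp; rewrite -scaleN1r; exact: supportedZ.
apply/prime_idealP; split; first exact: supported0.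
- by rewrite -mpolyX0 => /supportedX /=; rewrite fdeg0.
- exact: face_pow_lin.
move=> p q Ppq; have [p0 Fp Pp] := face_free_proj F p.
have [q0 Fq Pq] := face_free_proj F q.
have : p0 * q0 = 0.
  apply: (@face_free_eq0 F).
    by apply: supportedM Fp Fq => m m' /= e e'; rewrite fdegD e e'.
  have -> : p0 * q0 = p * q - ((p - p0) * q + p0 * (q - q0)).
    by rewrite mulrBl mulrBr addrA addrNK opprB addrC addrNK.
  apply: supportedD => //; apply: oppP; apply: supportedD.
    by rewrite mulrC; exact: (supportedMl (@fdeg_upward F 1) Pp).
  by exact: (supportedMl (@fdeg_upward F 1) Pq).
move=> /eqP; rewrite mulf_eq0 => /orP[] /eqP e; [left|right].
  by rewrite -[p]subr0 -e.
by rewrite -[q]subr0 -e.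
Qed.

Lemma mpolyX_subU m i : (0 < m i)%N -> 'X_[m] = 'X_[m - U_(i)] * 'X_i :> {mpoly K[n]}.
Proof. by move=> mi; rewrite -mpolyXD submK // lep1mP -lt0n. Qed.

(** One inclusion is additivity of [fdeg]. For the other, [k] variables of [F] are split off each
    monomial, one at a time. *)
Lemma ideal_pow_face F k : ideal_pow (face_prime F) k = face_pow F k.
Proof.
apply/seteqP; split.
  apply: ideal_span_sub; [exact: supported0|exact: face_pow_lin|].
  move=> _ [y yF ->]; elim: k y yF => [|k IH] y yF.
    by rewrite big_ord0 => m _.
  rewrite big_ord_recl.
  apply: (supportedM (U := [set m | (1 <= fdeg F m)%N])) (yF ord0) (IH _ _) => //.
  by move=> m m' /= h h'; rewrite fdegD -(add1n k) leq_add.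
move=> p Fp; rewrite [p]mpolyE; apply: ideal_span_sum => m /Fp /= km.
move: (p@_m) => c {p Fp}.
suff [q [y yF ->]] : exists q, exists2 y : 'I_k -> {mpoly K[n]},
    forall i, face_prime F (y i) & 'X_[m] = q * \prod_i y i.
  by rewrite scalerAl; apply: ideal_spanM; exists y.
elim: k m km => [|k IH] m km.
  by exists 'X_[m], (fun=> 0); [case|rewrite big_ord0 mulr1].
have [i iF mi] : exists2 i, i \in F & (0 < m i)%N.
  by apply: fdeg_gt0; apply: leq_trans km.
have le : (U_(i) <= m)%MM by rewrite lep1mP -lt0n.
have [|q [y yF e]] := IH (m - U_(i))%MM.
  by rewrite -(leq_add2r 1) addn1 (leq_trans km) // -{1}(submK le) fdegD fdeg1 iF.
exists q, (fun j => if unlift ord0 j is Some j' then y j' else 'X_i).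
  by move=> j; case: unliftP => [j' _|_] //; apply/face_primeX.
rewrite big_ord_recl unlift_none (mpolyX_subU mi) e -mulrA; congr (_ * _).
by rewrite mulrC; congr (_ * _); apply: eq_bigr => j _; rewrite liftK.
Qed.

(** The supports of the exponents in [G] are the edges of a hypergraph, and [F] is a vertex cover of
    it. *)
Definition covers G F := forall m, G m -> exists2 i, i \in F & (0 < m i)%N.

Definition min_cover G F :=
  covers G F /\ forall F', covers G F' -> F' \subset F -> F' = F.

Lemma sub_face_prime G F : monomial_span G `<=` face_prime F <-> covers G F.
Proof.
split=> [h m Gm|cF].
  apply: fdeg_gt0; suff: face_prime F 'X_[m] by move/supportedX.
  apply: h; rewrite monomial_spanE.
  exact/supportedX/sub_upset.
rewrite monomial_spanE => p Gp m /Gp[g /cF[i iF gi] gm].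
rewrite /=; apply: leq_trans (fdeg_le F gm); exact: fdeg_gt0_var gi.
Qed.

Lemma face_prime_subset F F' : face_prime F `<=` face_prime F' <-> F \subset F'.
Proof.
split=> [h|/fintype.subsetP sF p Fp m /Fp /fdeg_gt0[i iF mi]].
  by apply/fintype.subsetP => i /face_primeX /h /face_primeX.
by apply: fdeg_gt0_var mi; apply: sF.
Qed.

Lemma face_prime_inj : injective face_prime.
Proof.
by move=> F F' e; apply/eqP; rewrite finset.eqEsubset; apply/andP; split;
  apply/face_prime_subset; rewrite e.
Qed.

Definition vars_in Q : {set 'I_n} := [set i | `[< Q 'X_i >]]%SET.

Lemma vars_inP Q i : reflect (Q 'X_i) (i \in vars_in Q).
Proof. by rewrite inE; exact: asboolP. Qed.

Lemma face_prime_vars_in Q : prime_ideal Q -> face_prime (vars_in Q) `<=` Q.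
Proof.
move=> /prime_idealP[Q0 _ Qlin _] p Fp; rewrite [p]mpolyE.
rewrite big_seq; elim/big_rec: _ => // m q /Fp /fdeg_gt0[i /vars_inP Qi mi] Qq.
by rewrite (mpolyX_subU mi) scalerAl; apply: Qlin.
Qed.

(** A prime containing a monomial contains one of the variables dividing it. *)
Lemma covers_vars_in G Q : prime_ideal Q -> monomial_span G `<=` Q ->
  covers G (vars_in Q).
Proof.
move=> Qp sGQ m Gm; have : Q 'X_[m].
  by apply: sGQ; rewrite monomial_spanE; apply/supportedX/sub_upset.
rewrite mpolyXE_id => /(prime_ideal_prod Qp)[i _ /(prime_ideal_exp Qp)[mi Qi]].
by exists i => //; apply/vars_inP.
Qed.

Lemma vars_in_face F : vars_in (face_prime F) = F.
Proof. by apply/setP => i; apply/vars_inP/idP => /face_primeX. Qed.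

Lemma vars_in_sub P Q : P `<=` Q -> vars_in P \subset vars_in Q.
Proof. by move=> PQ; apply/fintype.subsetP => i /vars_inP /PQ /vars_inP. Qed.

(** A prime over the ideal contains the face prime of its own variables, which also lies over the
    ideal. This reduces minimality among primes to minimality among covers. *)
Lemma minimal_primesP G P : minimal_primes (monomial_span G) P <->
  exists2 F, min_cover G F & P = face_prime F.
Proof.
split=> [[Pp sGP min]|[F [cF min] ->]].
  have cP := covers_vars_in Pp sGP.
  have eP : P = face_prime (vars_in P).
    apply/esym/min; [exact: face_prime_prime|exact/sub_face_prime|].
    exact: face_prime_vars_in.
  exists (vars_in P) => //; split=> // F cF sF.
  apply: face_prime_inj; rewrite -eP; apply: min.
  - exact: face_prime_prime.
  - exact/sub_face_prime.
  - by rewrite eP; apply/face_prime_subset.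
split; [exact: face_prime_prime|exact/sub_face_prime|].
move=> Q Qp sGQ sQ.
have e : vars_in Q = F.
  apply: min; first exact: covers_vars_in.
  by have := vars_in_sub sQ; rewrite vars_in_face.
by apply/seteqP; split=> //; rewrite -e; apply: face_prime_vars_in.
Qed.

Lemma min_cover_below G F : covers G F -> exists2 F', min_cover G F' & F' \subset F.
Proof.
have [d] := ubnP #|F|; elim: d F => // d IH F; rewrite ltnS => dF cF.
have [min|nmin] := pselect (min_cover G F); first by exists F.
have /existsNP[F' /not_implyP[cF' /not_implyP[sF ne]]] :
  ~ forall F', covers G F' -> F' \subset F -> F' = F by move=> h; apply: nmin.
have lt : (#|F'| < #|F|)%N.
  by apply: proper_card; rewrite finset.properEneq sF andbT; apply/eqP.
have [F0 mF0 s0] := IH F' (leq_trans lt dF) cF'.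
by exists F0 => //; apply: fintype.subset_trans sF.
Qed.

Definition symbolic_exponents G k : set 'X_{1..n} :=
  [set m | forall F, min_cover G F -> (k <= fdeg F m)%N].

Lemma symbolic_powerE G k : symbolic_power (monomial_span G : set {mpoly K[n]}) k =
  supported (symbolic_exponents G k).
Proof.
apply/seteqP; split=> p /= h.
  move=> m mp F mF; suff : face_pow F k p by apply.
  by rewrite -ideal_pow_face; apply: h; apply/minimal_primesP; exists F.
move=> _ /minimal_primesP[F mF ->]; rewrite ideal_pow_face => m mp.
exact: h.
Qed.

End FacePrimes.

(** * Heights of face primes by counting monomials *)

Section Height.
Variables (K : fieldType) (n : nat).
Implicit Types (F : {set 'I_n}) (p q g : {mpoly K[n]}) (m : 'X_{1..n}).
Implicit Types (Q P : set {mpoly K[n]}).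

(** For an ideal [Q]: linear independence over [K] in the quotient by [Q]. *)
Definition free_mod Q (E : finType) (b : E -> {mpoly K[n]}) :=
  forall c : E -> K, Q (\sum_e c e *: b e) -> forall e, c e = 0.

(** Only monomials with all exponents at most [B] occur, and there are [B.+1 ^ n] of them.
    Independence makes the coefficient matrix row-free, so its rows are no more numerous than its
    columns. *)
Lemma card_free_le (E : finType) (b : E -> {mpoly K[n]}) (B : nat) :
  (forall e m, m \in msupp (b e) -> (mdeg m <= B)%N) ->
  (forall c : E -> K, \sum_e c e *: b e = 0 -> forall e, c e = 0) ->
  (#|E| <= B.+1 ^ n)%N.
Proof.
move=> bB ind; pose X : finType := {ffun 'I_n -> 'I_B.+1}.
pose mon (x : X) : 'X_{1..n} := [multinom x i : nat | i < n].
pose A := \matrix_(i < #|E|, j < #|X|) (b (enum_val i))@_(mon (enum_val j)).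
have fA : row_free A.
  apply: inj_row_free => v vA; apply/rowP => i; rewrite mxE.
  pose c e := v 0 (enum_rank e).
  suff s0 : \sum_e c e *: b e = 0 by rewrite -(ind c s0 (enum_val i)) /c enum_valK.
  apply/mpolyP => m; rewrite mcoeff0 raddf_sum /=.
  have [mB|nB] := boolP [forall i, (m i < B.+1)%N].
    pose x : X := [ffun i => inord (m i)].
    have ex : mon x = m.
      by apply/mnmP => j; rewrite mnmE ffunE inordK //; apply: (forallP mB).
    have /rowP/(_ (enum_rank x)) := vA; rewrite !mxE => s0.
    rewrite -[RHS]s0 (reindex (@enum_val E predT)) /=; last first.
      by exists enum_rank => ? _; [apply: enum_valK|apply: enum_rankK].
    by apply: eq_bigr => j _; rewrite mcoeffZ !mxE enum_rankK ex /c enum_valK.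
  rewrite big1 // => e _; rewrite mcoeffZ memN_msupp_eq0 ?mulr0 //.
  apply: contra nB => /bB md; apply/forallP => j; rewrite ltnS.
  by apply: leq_trans md; rewrite mdegE (bigD1 j) //= leq_addr.
have := rank_leq_col A; rewrite (eqP fA) => /leq_trans; apply.
by rewrite card_ffun !card_ord.
Qed.

(* Modulo Q only the constant term in g of a relation survives, so it vanishes; the rest can
   be divided by g because Q' is prime. *)
Lemma free_mod_powers Q Q' g (E : finType) (b : E -> {mpoly K[n]}) D :
  prime_ideal Q -> prime_ideal Q' -> Q' `<=` Q -> Q g -> ~ Q' g -> free_mod Q b ->
  free_mod Q' (fun ae : 'I_D * E => g ^+ ae.1 * b ae.2).
Proof.
move=> /prime_idealP[Q0 _ Qlin _] /prime_idealP[_ _ _ Q'M] sQ Qg nQ'g ind c.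
(* Coefficients indexed by all naturals turn division by [g] into an index shift; at the end [c] is
   extended by [0] beyond [D]. *)
have main N (c' : nat -> E -> K) :
    Q' (\sum_(a < N) g ^+ a * (\sum_e c' a e *: b e)) ->
    forall a e, (a < N)%N -> c' a e = 0.
  elim: N c' => [|N IH] c' //; rewrite big_ord_recl expr0 mul1r.
  set t := \sum_(a < N) _.
  have -> : t = g * \sum_(a < N) g ^+ a * (\sum_e c' a.+1 e *: b e).
    rewrite mulr_sumr; apply: eq_bigr => a _.
    by rewrite mulrA -exprS.
  set t' := \sum_(a < N) _ => Q't; have c'0 e : c' 0%N e = 0.
    apply: ind; have := Qlin (- t') g _ Qg (sQ _ Q't).
    by rewrite mulNr mulrC addrCA addNr addr0.
  move: Q't; rewrite big1 => [|e _]; last by rewrite c'0 scale0r.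
  rewrite add0r => /Q'M[//|/(IH (fun a => c' a.+1)) IH'].
  by case=> [|a] e; [rewrite c'0|apply: IH'].
move=> Q'c [a e]; have := main D (fun a e => oapp (fun a' => c (a', e)) 0 (insub a)).
move/(_ _ a e (ltn_ord a)); rewrite /= valK /=; apply.
congr Q': Q'c.
rewrite (eq_bigr (fun x : 'I_D * E => c (x.1, x.2) *: (g ^+ x.1 * b x.2))) => [|[]//].
rewrite -(pair_bigA _ (fun a e => c (a, e) *: (g ^+ a * b e))) /=.
apply: eq_bigr => a' _; rewrite mulr_sumr; apply: eq_bigr => e' _.
by rewrite valK /= scalerAr.
Qed.

(** The family consists of the monomials in the variables outside [F] with exponents below [D]; an
    [F]-free polynomial in the face prime is zero. *)
Lemma free_mod_face F D : exists (E : finType) (b : E -> {mpoly K[n]}),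
  [/\ #|E| = (D ^ (n - #|F|))%N,
      forall e m, m \in msupp (b e) -> (mdeg m <= D * n)%N
    & free_mod (face_prime F) b].
Proof.
pose T := {i : 'I_n | i \notin F}.
pose E : finType := {ffun T -> 'I_D}.
pose mon (x : E) : 'X_{1..n} :=
  [multinom oapp (fun t : T => x t : nat) 0%N (insub i) | i < n].
have mon_inj : injective mon.
  move=> x y e; apply/ffunP => t; apply/val_inj.
  by move/mnmP/(_ (val t)): e; rewrite !mnmE valK.
exists E, (fun x => 'X_[mon x]); split.
- rewrite card_ffun card_ord card_sig; congr (_ ^ _)%N.
  have -> : #|[pred x | x \notin F]| = #|finset.setC F|.
    by apply: eq_card => i; rewrite !inE.
  by have /(congr1 (subn^~ #|F|)) := finset.cardsC F; rewrite card_ord addKn.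
- move=> x m; rewrite msuppX mem_seq1 => /eqP ->; rewrite mdegE.
  rewrite mulnC -[n in X in (_ <= X)%N]card_ord -sum_nat_const leq_sum // => i _.
  by rewrite mnmE; case: insubP => //= t _ _; rewrite ltnW.
move=> c Fc x; have s0 : \sum_e c e *: 'X_[mon e] = 0 :> {mpoly K[n]}.
  apply: face_free_eq0 Fc; apply: supported_sum => y _.
  apply: supportedZ; apply/supportedX; rewrite /= /fdeg big1 // => i iF.
  by rewrite mnmE insubF ?iF.
have /(congr1 (mcoeff (mon x))) := s0; rewrite mcoeff0 raddf_sum /= (bigD1 x) //=.
rewrite mcoeffZ mcoeffX eqxx mulr1 big1 ?addr0 // => y yx.
by rewrite mcoeffZ mcoeffX (inj_eq mon_inj) (negbTE yx) mulr0.
Qed.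

Lemma mdeg_msuppM p q a b :
  (forall m, m \in msupp p -> (mdeg m <= a)%N) ->
  (forall m, m \in msupp q -> (mdeg m <= b)%N) ->
  forall m, m \in msupp (p * q) -> (mdeg m <= a + b)%N.
Proof.
by move=> pa qb m /msuppM_le/allpairsP[[u v] /= [/pa ? /qb ? ->]]; rewrite mdegD leq_add.
Qed.

Lemma mdeg_msupp_exp p a k :
  (forall m, m \in msupp p -> (mdeg m <= a)%N) ->
  forall m, m \in msupp (p ^+ k) -> (mdeg m <= k * a)%N.
Proof.
move=> pa; elim: k => [|k IH] m; last by rewrite exprS mulSn; apply: mdeg_msuppM.
by rewrite expr0 msupp1 mem_seq1 => /eqP ->; rewrite mdeg0.
Qed.

Lemma prime_chain_face_le F h : prime_chain (face_prime F : set {mpoly K[n]}) h -> (h <= #|F|)%N.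
Proof.
move=> [C [Cp Clt Ch]].
(* The constant [d] is chosen before [D]: degrees grow linearly in [D], while the family grows like
   a power of [D]. The proof descends the chain from [C h], one factor [D] per step. *)
have [d Hd] : exists d, forall D, exists (E : finType) (b : E -> {mpoly K[n]}),
    [/\ #|E| = (D ^ (h + (n - #|F|)))%N,
        forall e m, m \in msupp (b e) -> (mdeg m <= D * d)%N
      & free_mod (C 0%N) b].
  suff main j : (j <= h)%N -> exists d, forall D, exists (E : finType) (b : E -> {mpoly K[n]}),
    [/\ #|E| = (D ^ (j + (n - #|F|)))%N,
        forall e m, m \in msupp (b e) -> (mdeg m <= D * d)%N
      & free_mod (C (h - j)%N) b].
    by have := main h (leqnn h); rewrite subnn.
  elim: j => [_|j IH jh].
    by exists n => D; rewrite subn0 Ch; apply: free_mod_face.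
  have [d Hd] := IH (ltnW jh).
  have ehj : ((h - j.+1).+1 = h - j)%N by rewrite -subSn // subSS.
  have lt : (h - j.+1 < h)%N by rewrite -subSn // subSS leq_subr.
  have := Clt _ lt; rewrite ehj => -[sC nsC].
  have [g Cg nCg] : exists2 g, C (h - j)%N g & ~ C (h - j.+1)%N g.
    apply: contrapT => no; apply: nsC => g Cg; apply: contrapT => nCg.
    by apply: no; exists g.
  (* [msize g] exceeds the degree of [g], so the powers of [g] below the [D]-th have degree at most
     [D * msize g]. *)
  exists (msize g + d)%N => D; have [E [b [cE bd ind]]] := Hd D.
  exists ('I_D * E)%type, (fun ae : 'I_D * E => g ^+ ae.1 * b ae.2); split.
  - by rewrite card_prod card_ord cE addSn expnS.
  - move=> [a e] m /= mm; rewrite mulnDr.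
    apply: (mdeg_msuppM _ (bd e) mm) => m' m'g.
    apply: (@leq_trans (a * msize g)); last by rewrite leq_mul2r ltnW ?orbT.
    by apply: mdeg_msupp_exp m'g => u /msize_mdeg_lt/ltnW.
  - by apply: free_mod_powers Cg nCg ind => //; apply: Cp; apply: leq_subr.
rewrite leqNgt; apply/negP => Fh.
(* With this [D], [(D * d.+1) ^ n < D ^ n.+1], whereas [#|F| < h] makes the family have at least
   [D ^ n.+1] members. *)
pose D := (d.+1 ^ n).+1.
have [E [b [cE bd ind]]] := Hd D.
have /prime_idealP[C0 _ _ _] := Cp 0%N (leq0n h).
have : (#|E| <= (D * d).+1 ^ n)%N.
  apply: card_free_le bd _ => c c0; apply: ind; by rewrite c0.
rewrite cE leqNgt => /negP; apply.
have Fn : (#|F| <= n)%N by rewrite -[X in (_ <= X)%N]card_ord max_card.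
apply: (@leq_trans (D ^ n.+1)); last first.
  rewrite leq_pexp2l //; apply: (@leq_trans (#|F|.+1 + (n - #|F|))%N).
    by rewrite addSn subnKC.
  by rewrite leq_add2r.
rewrite expnSr; apply: (@leq_ltn_trans ((D * d.+1) ^ n)).
  have [->|n_gt0] := posnP n; first by rewrite !expn0.
  by rewrite leq_exp2r // mulnS -add1n leq_add2r.
by rewrite expnMn ltn_mul2l expn_gt0 /=.
Qed.

(** The variables of [F] are added one at a time, starting from the zero ideal. *)
Lemma prime_chain_face F : prime_chain (face_prime F : set {mpoly K[n]}) #|F|.
Proof.
pose S i : {set 'I_n} := [set x in take i (enum F)]%SET.
exists (fun i => face_prime (S i)); split=> [i _|i iF|].
- exact: face_prime_prime.
- have lt : (i < size (enum F))%N by rewrite -cardE.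
  have /card_gt0P[x0 _] : (0 < #|F|)%N by apply: leq_trans iF.
  rewrite /S (take_nth x0 lt); split.
    apply/face_prime_subset/fintype.subsetP => x.
    by rewrite !inE mem_rcons in_cons => ->; rewrite orbT.
  move=> /face_prime_subset/fintype.subsetP/(_ (nth x0 (enum F) i)).
  rewrite !inE mem_rcons mem_head => /(_ isT); apply/negP.
  have := enum_uniq F; rewrite -[X in uniq X](cat_take_drop i) (drop_nth x0 lt).
  by rewrite cat_uniq /= negb_or => /and3P[_ /andP[]].
- congr face_prime; apply/setP => x; rewrite inE take_oversize ?mem_enum //.
  by rewrite cardE.
Qed.

Lemma prime_height_face F : prime_height (face_prime F : set {mpoly K[n]}) = #|F|.
Proof.
apply/eqP; rewrite eqn_leq; apply/andP; split.
  by apply: nat_supremum_le => h /prime_chain_face_le.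
apply: nat_le_supremum (prime_chain_face F) => h.
exact: prime_chain_face_le.
Qed.

Lemma height_monomial_span (G : set 'X_{1..n}) F : min_cover G F ->
  (forall F', min_cover G F' -> (#|F| <= #|F'|)%N) ->
  height (monomial_span G : set {mpoly K[n]}) = #|F|.
Proof.
move=> mF le; apply: nat_infimum_eq.
  exists (face_prime F); last exact: prime_height_face.
  by apply/minimal_primesP; exists F.
move=> _ [P /minimal_primesP[F' mF' ->] <-]; rewrite prime_height_face.
exact: le.
Qed.

Lemma min_cover_card (G : set 'X_{1..n}) : (exists F, covers G F) ->
  exists2 F, min_cover G F & forall F', min_cover G F' -> (#|F| <= #|F'|)%N.
Proof.
move=> [F0 /min_cover_below[F1 mF1 _]].
have ex : exists k, `[< exists2 F, min_cover G F & #|F| = k >].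
  by exists #|F1|; apply/asboolP; exists F1.
case: (ex_minnP ex) => k /asboolP[F mF <-] min; exists F => // F' mF'.
by apply: min; apply/asboolP; exists F'.
Qed.

End Height.

Definition squarefree n (G : set 'X_{1..n}) := forall m, G m -> forall i, (m i <= 1)%N.

(** * Replacing the vertices of a clutter by copies *)

Section Duplication.
Variables (n N : nat) (pi : 'I_N -> 'I_n).
Implicit Types (F : {set 'I_n}) (G : set 'X_{1..n}) (m : 'X_{1..N}).

(** The exponent of the image of a monomial when each copy [x] is replaced by the variable
    [pi x]. *)
Definition push m : 'X_{1..n} :=
  [multinom (\sum_(x | pi x == i) m x)%N | i < n].

Definition dup G : set 'X_{1..N} := [set m | G (push m)].

Lemma mdeg_push m : mdeg (push m) = mdeg m.
Proof.
rewrite !mdegE [in RHS](partition_big pi predT) //=.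
by apply: eq_bigr => i _; rewrite mnmE.
Qed.

Lemma le_push m x : (m x <= push m (pi x))%N.
Proof. by rewrite mnmE (bigD1 x) //= leq_addr. Qed.

Lemma squarefree_dup G : squarefree G -> squarefree (dup G).
Proof. by move=> sqG m Gm x; apply: leq_trans (le_push m x) (sqG _ Gm _). Qed.

Lemma covers_dup G F : covers G F -> covers (dup G) (pi @^-1: F).
Proof.
move=> cF m /cF[i iF]; rewrite mnmE lt0n sum_nat_eq0 negb_forall => /existsP[x].
rewrite negb_imply -lt0n => /andP[/eqP xi mx]; exists x => //.
by rewrite inE xi.
Qed.

(* The vertices all of whose copies lie in a cover of the duplicated clutter form a cover:
   an edge missing them lifts to an edge through copies outside the cover. *)
Lemma covers_dup_full G (F' : {set 'I_N}) : squarefree G -> covers (dup G) F' ->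
  exists2 F, covers G F & pi @^-1: F \subset F'.
Proof.
move=> sqG cF'; pose F := [set i | [forall x, (pi x == i) ==> (x \in F')]]%SET.
exists F; last first.
  by apply/fintype.subsetP => x; rewrite !inE => /forallP/(_ x); rewrite eqxx.
move=> m Gm; apply: contrapT => no.
(* A vertex outside [F] has a copy outside [F']; [m'] uses one such copy for each vertex of the edge
   [m]. *)
pose pick_at i := [pick y | (pi y == i) && (y \notin F')].
pose m' : 'X_{1..N} :=
  [multinom ((0 < m (pi x)) && (pick_at (pi x) == Some x) : nat)%N | x < N].
have pm' : push m' = m.
  apply/mnmP => i; rewrite mnmE; have [mi|mi] := posnP (m i).
    by rewrite mi big1 // => x /eqP xi; rewrite mnmE xi mi.
  have : i \notin F by apply/negP => iF; apply: no; exists i.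
  rewrite inE negb_forall => /existsP[x0]; rewrite negb_imply => x0i.
  have -> : m i = 1%N by apply/eqP; rewrite eqn_leq mi (sqG _ Gm).
  case E: (pick_at i) => [y|]; last first.
    by move: E; rewrite /pick_at; case: pickP => // /(_ x0); rewrite x0i.
  have yi : pi y == i.
    by move: E; rewrite /pick_at; case: pickP => // z /andP[zi _] [<-].
  rewrite (bigD1 y) //= mnmE (eqP yi) mi E eqxx big1 // => x /andP[/eqP xi xy].
  by rewrite mnmE xi E mi /=; case: eqP => // -[yx]; rewrite yx eqxx in xy.
have /cF'[x xF'] : dup G m' by rewrite /dup /= pm'.
rewrite mnmE lt0b => /andP[_ /eqP]; rewrite /pick_at.
by case: pickP => // y /andP[_ yF'] [e]; rewrite e xF' in yF'.
Qed.

(** [F'] contains the preimage of a cover, hence of a minimal one; that preimage is itself a cover,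
    so minimality gives equality. *)
Lemma min_cover_dup G (F' : {set 'I_N}) : squarefree G -> min_cover (dup G) F' ->
  exists2 F, min_cover G F & F' = pi @^-1: F.
Proof.
move=> sqG [cF' min]; have [F1 /min_cover_below[F mF sF] s1] := covers_dup_full sqG cF'.
exists F => //; apply/esym/min; first exact/covers_dup/(proj1 mF).
apply: fintype.subset_trans s1; exact: preimsetS.
Qed.

(** Restricting [m] to the copies of the vertices of a minimal [g] below [push m] gives an edge over
    [g], since all exponents involved are at most 1. By minimality this edge is [m]. *)
Lemma minimal_dup G m : squarefree G -> minimal_in (upset (dup G)) m ->
  exists2 g, minimal_in (upset G) g & mdeg g = mdeg m.
Proof.
move=> sqG minm; have Gm : G (push m) := minimal_in_upset minm.
have [g ming gm] := minimal_below (sub_upset Gm).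
exists g => //; have Gg := minimal_in_upset ming.
pose m' : 'X_{1..N} := [multinom (if (0 < g (pi x))%N then m x else 0%N) | x < N].
suff pm' : push m' = g.
  rewrite -pm' mdeg_push; congr mdeg; apply: minm.2.
    by apply: sub_upset; rewrite /dup /= pm'.
  by apply/mnm_lepP => x; rewrite mnmE; case: ifP.
apply/mnmP => i; rewrite mnmE; have := mnm_lepP gm i; have := sqG _ Gm i.
rewrite mnmE; case: (posnP (g i)) => [gi _ _|gi le1 le2].
  by rewrite gi big1 // => x /eqP xi; rewrite mnmE xi gi.
rewrite (eq_bigr m) => [|x /eqP xi]; last by rewrite mnmE xi gi.
by apply/eqP; rewrite eqn_leq le2 andbT (leq_trans le1).
Qed.

Lemma card_preim_pi F (a : 'X_{1..n}) :
  (forall i, #|[pred x | pi x == i]| = a i) -> #|pi @^-1: F| = fdeg F a.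
Proof.
move=> ha; rewrite -sum1_card (partition_big pi (mem F)) => [|x]; last by rewrite inE.
apply: eq_bigr => i iF; rewrite -ha -sum1_card; apply: eq_bigl => x.
by rewrite !inE andbC; case: eqP => //= ->; apply/esym.
Qed.

End Duplication.

(** The disjoint union of the ['I_(a i)] has [mdeg a] elements; [pi] enumerates it and keeps the
    tag. *)
Lemma exists_fibers n (a : 'X_{1..n}) : exists pi : 'I_(mdeg a) -> 'I_n,
  forall i, #|[pred x | pi x == i]| = a i.
Proof.
pose T : finType := {i : 'I_n & 'I_(a i)}.
have cT : #|T| = mdeg a.
  rewrite card_tagged sumnE big_map big_enum mdegE.
  by apply: eq_bigr => i _; rewrite card_ord.
rewrite -cT; exists (fun x => tag (enum_val x : T)) => i.
rewrite -sum1_card big_mkcond (reindex (@enum_rank T)) /=; last first.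
  by exists enum_val => ? _; [apply: enum_rankK|apply: enum_valK].
rewrite (eq_bigr (fun t : T => if tag t == i then 1 else 0)%N) => [|t _]; last first.
  by rewrite inE /= enum_rankK.
rewrite -(sig_big_dep (fun=> true) (fun _ _ => true)
           (fun j (_ : 'I_(a j)) => if j == i then 1 else 0)%N) /=.
rewrite (bigD1 i) //= eqxx sum1_card card_ord big1 ?addn0 // => j /negbTE ->.
by rewrite big1.
Qed.

(** * Minimal generators of symbolic powers *)

Section SymbolicPowers.
Variables (K : fieldType) (n : nat).
Implicit Types (F : {set 'I_n}) (m : 'X_{1..n}) (G : set 'X_{1..n}).

Lemma squarefree_monomial_idealP (I : set {mpoly K[n]}) :
  squarefree_monomial_ideal I -> I <> [set 0] -> I <> [set: {mpoly K[n]}] ->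
  exists G, [/\ squarefree G, I = monomial_span G, G !=set0 & ~ G 0%MM].
Proof.
move=> [G sqG ->] I0 IT; exists G; split=> //.
  apply: contrapT => /nonemptyPn G0; apply: I0; rewrite monomial_spanE.
  apply/seteqP; split=> [p Gp|_ ->]; last exact: supported0.
  apply: msuppnil0; case E: (msupp p) => [//|m s].
  have /Gp[g] : m \in msupp p by rewrite E mem_head.
  by rewrite G0.
move=> G0; apply: IT; rewrite monomial_spanE.
by apply/(supported1 _ (@upset_upward _ G)); apply: sub_upset.
Qed.

Lemma covers_setT G : ~ G 0%MM -> covers G finset.setT.
Proof.
move=> nG0 m Gm; apply: contrapT => no; apply: nG0.
suff <- : m = 0%MM by [].
apply/mnmP => i; rewrite mnm0E; have [//|mi] := posnP (m i).
by case: no; exists i => //; rewrite finset.in_setT.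
Qed.

Lemma symbolic_exponents_upward G k : upward (symbolic_exponents G k).
Proof. by move=> m m' h le F /h km; apply: leq_trans km (fdeg_le F le). Qed.

(** Lowering the exponent of [i] by one leaves the symbolic power, so the weight of some minimal
    cover drops below [k]. That cover contains [i] and had weight exactly [k]. *)
Lemma minimal_symbolic_tight G k m i :
  minimal_in (symbolic_exponents G k) m -> (0 < m i)%N ->
  exists F, [/\ min_cover G F, i \in F & fdeg F m = k].
Proof.
move=> [Sm min] mi; have le : (U_(i) <= m)%MM by rewrite lep1mP -lt0n.
have /existsNP[F /not_implyP[mF /negP lt]] : ~ symbolic_exponents G k (m - U_(i))%MM.
  move=> /min/(_ (lem_subr _ _))/mnmP/(_ i); rewrite mnmBE mnm1E eqxx => e.
  by have := ltn_subrL 1 (m i); rewrite mi e ltnn.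
have em : fdeg F m = (fdeg F (m - U_(i))%MM + (i \in F))%N.
  by rewrite -fdeg1 -fdegD submK.
have := Sm F mF; rewrite -ltnNge in lt; rewrite em; move: em.
case iF: (i \in F) => /=; last by rewrite addn0 leqNgt lt.
rewrite addn1 => em kle; exists F; split=> //.
by apply/eqP; rewrite em eqn_leq lt.
Qed.

Lemma minimal_symbolic_le G k m :
  minimal_in (symbolic_exponents G k) m -> forall i, (m i <= k)%N.
Proof.
move=> minm i; have [->//|mi] := posnP (m i).
have [F [_ iF <-]] := minimal_symbolic_tight minm mi.
by rewrite /fdeg (bigD1 i) //= leq_addr.
Qed.

Lemma fdeg_lt F m m' i : (m <= m')%MM -> i \in F -> (m i < m' i)%N ->
  (fdeg F m < fdeg F m')%N.
Proof.
move=> /mnm_lepP le iF lti; rewrite /fdeg (bigD1 i) //= [X in (_ < X)%N](bigD1 i) //=.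
by rewrite -addSn leq_add // leq_sum.
Qed.

Lemma min_cover_gt0 G F : G !=set0 -> covers G F -> (0 < #|F|)%N.
Proof. by move=> [m Gm] /(_ m Gm)[i iF _]; apply/card_gt0P; exists i. Qed.

End SymbolicPowers.

Theorem proposition6p4 (K : fieldType) (f : nat -> nat)
    (f_nondecreasing : forall a b : nat, (a <= b)%N -> (f a <= f b)%N) :
  (forall (n : nat) (I : set {mpoly K[n]}),
     squarefree_monomial_ideal I -> I <> [set 0] -> I <> [set: {mpoly K[n]}] ->
     forall k : nat, (1 <= k)%N ->
       (gen_degree (symbolic_power I k) <= k * f (gen_degree I))%N)
  <->
  (forall (n : nat) (I : set {mpoly K[n]}),
     squarefree_monomial_ideal I -> I <> [set 0] -> I <> [set: {mpoly K[n]}] ->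
     (forall i : 'I_n, exists P : set {mpoly K[n]},
        [/\ minimal_primes I P, prime_height P = height I & P 'X_i]) ->
     (n <= height I * f (gen_degree I))%N).
Proof.
split=> H n I sqI I0 IT.
  move=> tight.
  have [G [sqG eI G0 nG0]] := squarefree_monomial_idealP sqI I0 IT.
  have [|F0 mF0 minF0] := @min_cover_card n G.
    by exists finset.setT; apply: covers_setT.
  have hI : height I = #|F0| by rewrite eI; apply: height_monomial_span.
  have h_gt0 : (1 <= height I)%N by rewrite hI (min_cover_gt0 G0) //; case: mF0.
  apply: leq_trans (H n I sqI I0 IT _ h_gt0).
  rewrite {1}eI symbolic_powerE.
  (* The product of all variables, to be shown a minimal generator of the symbolic power of order
     [height I]. *)
  pose u : 'X_{1..n} := [multinom 1%N | i < n].
  have fu F : fdeg F u = #|F|.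
    by rewrite -sum1_card; apply: eq_bigr => i _; rewrite mnmE.
  have mu : mdeg u = n.
    by rewrite mdegE (eq_bigr (fun=> 1%N)) ?sum1_card ?card_ord // => i _; rewrite mnmE.
  rewrite -[X in (X <= _)%N]mu.
  apply: (@le_gen_degree K n _ (height I) u).
  - exact: symbolic_exponents_upward.
  - exact: minimal_symbolic_le.
  split=> [F mF|m Sm le]; first by rewrite fu hI; apply: minF0.
  apply: lepm_mdeg_eq => //; rewrite !mdegE leq_sum // => i _.
  rewrite mnmE leqNgt; apply/negP => mi.
  (* If [x_i] were missing from [m], the weight of [m] on a minimum cover through [i] would be below
     [height I]. *)
  have [P [minP hP Pi]] := tight i.
  move: minP; rewrite eI => /minimal_primesP[F mF eP].
  have iF : i \in F by apply/(face_primeX K); rewrite -eP.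
  have := Sm F mF; rewrite -hP eP prime_height_face -fu leqNgt => /negP; apply.
  by apply: (fdeg_lt le iF); rewrite mnmE.
move=> k k_gt0.
have [G [sqG eI G0 nG0]] := squarefree_monomial_idealP sqI I0 IT.
rewrite {1}eI symbolic_powerE.
apply: gen_degree_le => [|a mina]; first exact: symbolic_exponents_upward.
(* Each vertex [i] gets [a i] copies, so the preimage of [F] has [fdeg F a] elements. *)
have [pi fib] := exists_fibers a.
have cpi := card_preim_pi _ fib.
set N := mdeg a in pi fib cpi *.
pose J : set {mpoly K[N]} := monomial_span (dup pi G).
have mcJ F' : min_cover (dup pi G) F' -> (k <= #|F'|)%N.
  by move=> /(min_cover_dup sqG)[F mF ->]; rewrite cpi; apply: mina.1.
have [|F0 mF0 minF0] := @min_cover_card N (dup pi G).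
  by exists (pi @^-1: finset.setT); apply/covers_dup/covers_setT.
have tight x : exists F', [/\ min_cover (dup pi G) F', x \in F' & #|F'| = k].
  have ax : (0 < a (pi x))%N by rewrite -fib; apply/card_gt0P; exists x; rewrite inE.
  have [F [mF xF kF]] := minimal_symbolic_tight mina ax.
  have cF := covers_dup (proj1 mF) : covers (dup pi G) (pi @^-1: F).
  (* Minimality follows by counting: a cover inside this one contains a minimal cover, which has at
     least [k] elements. *)
  exists (pi @^-1: F); rewrite inE xF cpi; split=> //; split=> // F' cF' sF'.
  have [F1 mF1 s1] := min_cover_below cF'.
  apply/eqP; rewrite eqEcard sF' cpi kF.
  by apply: leq_trans (mcJ _ mF1) (subset_leq_card s1).
have hJ : height J = k.
  rewrite (height_monomial_span K mF0 minF0).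
  (* As [k] is positive there is a vertex, and [tight] then supplies a minimal cover of size exactly
     [k]. *)
  have /card_gt0P[x _] : (0 < #|F0|)%N by apply: leq_trans (mcJ _ mF0).
  have [F' [mF' _ kF']] := tight x.
  by apply/eqP; rewrite eqn_leq mcJ // andbT -kF' minF0.
have uJ : J = supported (upset (dup pi G)) by exact: monomial_spanE.
have dJ : (gen_degree J <= gen_degree I)%N.
  rewrite uJ eI monomial_spanE; apply: gen_degree_le => [|m]; first exact: upset_upward.
  move=> /(minimal_dup sqG)[g ming <-].
  apply: (@le_gen_degree K n _ 1) => //; first exact: upset_upward.
  by move=> m' /minimal_in_upset /sqG.
have : (N <= height J * f (gen_degree J))%N.
  apply: H.
  - by exists (dup pi G) => //; apply: squarefree_dup.
  (* Were [J] zero, the empty set would be a minimal cover with fewer than [k] elements. *)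
  - move=> J0; have : covers (dup pi G) finset.set0.
      apply/(sub_face_prime K); rewrite -/J J0 => _ ->; exact: supported0.
    move=> /min_cover_below[F /mcJ kF]; rewrite finset.subset0 => /eqP F_0.
    by move: kF; rewrite F_0 cards0 leqNgt k_gt0.
  - rewrite uJ => /(supported1 _ (@upset_upward _ _))[m Gm m0]; apply: nG0.
    suff <- : push pi m = 0%MM by [].
    apply/eqP; rewrite -mdeg_eq0 mdeg_push mdeg_eq0; apply/eqP/mnmP => x.
    by apply/eqP; rewrite mnm0E -leqn0 -(mnm0E x); apply: (mnm_lepP m0).
  - move=> x; have [F' [mF' xF' kF']] := tight x.
    exists (face_prime F'); split; [|by rewrite prime_height_face hJ|exact/face_primeX].
    by apply/minimal_primesP; exists F'.
(* Monotonicity of [f] passes from [gen_degree J] to [gen_degree I]. *)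
rewrite hJ => /leq_trans; apply.
by rewrite leq_mul2l f_nondecreasing ?orbT.
Qed.
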